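(* The constant $(1-1/q)^d$ in the inequality $\operatorname{MR}(M) \ge (1-1/q)^d \operatorname{CR}(M)$ (valid for all $\mathcal{M}_d$-matrices $M$ over $\mathbb{F}_q$) cannot be improved. That is, for every prime power $q$, every integer $d \ge 0$, and every real $c > (1-1/q)^d$, there exist $n \ge 1$ and an $\mathcal{M}_d$-matrix $M$ over $\mathbb{F}_q$ such that $\operatorname{MR}(M) < c\,\operatorname{CR}(M)$.
   Context: Let $\mathbb{F} = \mathbb{F}_q$ and let $x_i = (x_{i,1},\ldots,x_{i,n})$, $i = 1,\ldots,d$, be tuples of variables, where $n$ is an arbitrary (unbounded) parameter. $\mathcal{M}_d$ is the $\mathbb{F}$-vector space of multilinear forms linear in each of $x_1,\ldots,x_d$, i.e. the span of the monomials $x_{1,j_1}\cdots x_{d,j_d}$. An $\mathcal{M}_d$-matrix is a matrix (of any finite size) with entries in $\mathcal{M}_d$. The max-rank $\operatorname{MR}(M)$ is the maximum rank of the scalar matrix $M(p_1,\ldots,p_d)$ over $p_1,\ldots,p_d \in \mathbb{F}^n$. The commutative rank $\operatorname{CR}(M)$ is the rank of $M$ over the field of rational functions over $\mathbb{F}$ in the variables $x_{i,j}$. *)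

(* Defs.v *)
From HB Require Import structures.
From mathcomp Require Import all_boot all_order all_algebra.
From mathcomp Require Import mpoly reals.

Set Implicit Arguments.
Unset Strict Implicit.
Unset Printing Implicit Defensive.

Import Order.TTheory GRing.Theory Num.Theory.
Local Open Scope ring_scope.

(* The variable x_{i,j} of the polynomial ring over F in d * n variables; the
   pair (i, j) is flattened to the single index mxvec_index i j. *)
Definition xvar (F : finFieldType) (d n : nat) (i : 'I_d) (j : 'I_n) :
  {mpoly F[d * n]} := 'X_(mxvec_index i j).

(* Membership in the linear span of the monomials x_{1,j_1} ... x_{d,j_d};
   for d = 0 the span consists of the constants. *)
Definition multilinear_form (F : finFieldType) (d n : nat)
    (f : {mpoly F[d * n]}) : Prop :=
  exists a : {ffun {ffun 'I_d -> 'I_n} -> F},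
    f = \sum_(j : {ffun 'I_d -> 'I_n}) a j *: \prod_(i < d) xvar F i (j i).

Definition multilinear_mx (F : finFieldType) (d n r s : nat)
    (M : 'M[{mpoly F[d * n]}]_(r, s)) : Prop :=
  forall k l, multilinear_form (M k l).

(* M(p_1, ..., p_d), where p_i in F^n is the i-th row of p. *)
Definition eval_mx (F : finFieldType) (d n r s : nat)
    (M : 'M[{mpoly F[d * n]}]_(r, s)) (p : 'M[F]_(d, n)) : 'M[F]_(r, s) :=
  map_mx (meval (fun k => mxvec p 0 k)) M.

Definition max_rank (F : finFieldType) (d n r s : nat)
    (M : 'M[{mpoly F[d * n]}]_(r, s)) : nat :=
  \max_(p : 'M[F]_(d, n)) \rank (eval_mx M p).

Definition comm_rank (F : finFieldType) (d n r s : nat)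
    (M : 'M[{mpoly F[d * n]}]_(r, s)) : nat :=
  \rank (map_mx (@tofrac {mpoly F[d * n]}) M).

(* Main.v *)
(** Take the diagonal matrix whose entries are the products
    [l_1(x_1) * ... * l_d(x_d)], one for each [d]-tuple of linear forms on
    [F^n].  With [q = #|F|], exactly [(q^n - 1)^d] of these products are nonzero
    polynomials, whereas at any point at least [q^(n-1)] linear forms vanish in
    each slot, so at most [(q^n - q^(n-1))^d] entries survive evaluation.  The
    ratio tends to [(1 - 1/q)^d] as [n] grows. *)
Require Import Defs.
From HB Require Import structures.
From mathcomp Require Import all_boot all_order all_algebra.
From mathcomp Require Import mpoly reals.
From mathcomp Require mxabelem.

Set Implicit Arguments.
Unset Strict Implicit.
Unset Printing Implicit Defensive.

Import Order.TTheory GRing.Theory Num.Theory.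
Local Open Scope ring_scope.

(** Induction on the size: the first diagonal entry splits off as a 1-by-1 block, of rank 1 or 0
    according to whether it is nonzero. *)
Lemma rank_diag_mx (K : fieldType) (m : nat) (v : 'rV[K]_m) :
  \rank (diag_mx v) = #|[pred i | v 0 i != 0]|.
Proof.
rewrite -sum1_card big_mkcond /=.
elim: m v => [|m IHm] v; first by rewrite [diag_mx v]flatmx0 mxrank0 big_ord0.
have -> : \rank (diag_mx v) =
          \rank (diag_mx (row_mx (lsubmx (v : 'rV_(1 + m))) (rsubmx (v : 'rV_(1 + m))))).
  by rewrite hsubmxK.
rewrite diag_mx_row rank_diag_block_mx IHm.
rewrite big_ord_recl /= !inE; congr (_ + _)%N.
  rewrite [diag_mx _]mx11_scalar -[_%:M]scalemx1 !mxE eqxx mulr1n.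
  rewrite (_ : lshift m 0 = ord0); last exact: val_inj.
  by case: eqP => [->|/eqP nz]; rewrite ?scale0r ?mxrank0 // mxrank_scale_nz ?mxrank1.
apply: eq_bigr => i _; rewrite !inE mxE.
by rewrite (_ : rshift 1 i = lift ord0 i); last exact: val_inj.
Qed.

(** A single column has rank at most 1, so its left kernel has dimension at least [n] and contains
    at least [#|F| ^ n] vectors; the bound also covers [u = 0]. *)
Lemma card_vec_mul_neq0 (F : finFieldType) (n : nat) (u : 'cV[F]_n.+1) :
  (#|[pred v : 'rV[F]_n.+1 | v *m u != 0%R]| <= #|F| ^ n.+1 - #|F| ^ n)%N.
Proof.
have cardK : (#|F| ^ n <= #|[pred v : 'rV[F]_n.+1 | v *m u == 0%R]|)%N.
  have <- : #|mxabelem.rowg (kermx u)| =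
            #|[pred v : 'rV[F]_n.+1 | v *m u == 0%R]|.
    by apply: eq_card => v; rewrite mxabelem.mem_rowg sub_kermx inE.
  rewrite mxabelem.card_rowg mxrank_ker leq_exp2l; last exact: card_finNzRing_gt1.
  by have := rank_leq_col u; case: (\rank u) => [|[|k]]; rewrite ?subSS ?subn0.
have <- : (#|[pred v : 'rV[F]_n.+1 | v *m u == 0%R]| +
           #|[pred v : 'rV[F]_n.+1 | v *m u != 0%R]| = #|F| ^ n.+1)%N.
  by rewrite -[in RHS](mul1n n.+1) -card_mx -(cardC [pred v | v *m u == 0%R]).
by rewrite addnC -addnBA ?leq_addr.
Qed.

Lemma card_ffun_forall (I T : finType) (P : I -> pred T) :
  #|[pred a : {ffun I -> T} | [forall i, P i (a i)]]| = (\prod_i #|P i|)%N.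
Proof.
have -> : #|[pred a : {ffun I -> T} | [forall i, P i (a i)]]| =
          #|(family P : simpl_pred {ffun I -> T})|.
  by apply: eq_card => a; rewrite !inE; apply: eq_forallb.
by rewrite card_family foldrE big_map big_enum.
Qed.

Section Product_forms.
Variables (F : finFieldType) (d n : nat).
Implicit Types a : {ffun 'I_d -> 'rV[F]_n}.

(** The row [a i] is the coefficient vector of the linear form in slot [i]. *)
Definition prod_form a : {mpoly F[d * n]} :=
  \prod_(i < d) \sum_(j < n) a i 0 j *: xvar F i j.

Lemma prod_form_multilinear a : multilinear_form (prod_form a).
Proof.
exists [ffun j : {ffun 'I_d -> 'I_n} => \prod_(i < d) a i 0 (j i)].
rewrite /prod_form bigA_distr_bigA; apply: eq_bigr => j _.
by rewrite ffunE scaler_prod.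
Qed.

Lemma meval_prod_form a (p : 'M[F]_(d, n)) :
  meval (fun k => mxvec p 0 k) (prod_form a) =
  \prod_(i < d) (a i *m (row i p)^T) 0 0.
Proof.
rewrite rmorph_prod; apply: eq_bigr => i _.
rewrite raddf_sum mxE; apply: eq_bigr => j _.
by rewrite /= mevalZ mevalXU mxvecE !mxE.
Qed.

Lemma prod_form_neq0 a : (forall i, a i != 0) -> prod_form a != 0.
Proof.
move=> a_neq0; have /fin_all_exists [s s_neq0] i : exists j, a i 0 j != 0.
  by apply/rV0Pn/a_neq0.
(* Row [i] of [p] is the unit vector at [s i], so the [i]-th factor evaluates to the nonzero
   coefficient [a i 0 (s i)]. *)
pose p : 'M[F]_(d, n) := \matrix_(i, j) (j == s i)%:R.
apply/eqP => /(congr1 (meval (fun k => mxvec p 0 k))) /eqP.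
rewrite meval_prod_form meval0; apply/negP/prodf_neq0 => i _.
rewrite mxE (bigD1 (s i)) //= big1 => [|j /negPf ne_j].
  by rewrite !mxE eqxx mulr1 addr0.
by rewrite !mxE ne_j mulr0.
Qed.

Definition prod_form_mx : 'M[{mpoly F[d * n]}]_(#|{ffun 'I_d -> 'rV[F]_n}|) :=
  diag_mx (\row_k prod_form (enum_val k)).

Lemma prod_form_mx_multilinear : multilinear_mx prod_form_mx.
Proof.
move=> k l; rewrite !mxE; case: eqP => _; first exact: prod_form_multilinear.
exists [ffun=> 0]; rewrite big1 // => j _; by rewrite ffunE scale0r.
Qed.

(** Serves both ranks: [f] is the embedding into the fraction field for [comm_rank], and evaluation
    at a point for [max_rank]. *)
Lemma rank_map_prod_form_mx (K : fieldType) (f : {rmorphism {mpoly F[d * n]} -> K}) :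
  \rank (map_mx f prod_form_mx) = #|[pred a | f (prod_form a) != 0]|.
Proof.
rewrite map_diag_mx rank_diag_mx -(card_image enum_val_inj); apply: eq_card => a.
rewrite -[a]enum_rankK mem_image; last exact: enum_val_inj.
by rewrite !inE !mxE.
Qed.

(** Each tuple of nonzero coefficient vectors contributes a nonzero diagonal entry, because the
    embedding into fractions is injective. *)
Lemma comm_rank_prod_form_mx :
  ((#|F| ^ n).-1 ^ d <= comm_rank prod_form_mx)%N.
Proof.
rewrite /comm_rank rank_map_prod_form_mx.
have <- : #|[pred a : {ffun 'I_d -> 'rV[F]_n} | [forall i, a i != 0]]|
          = ((#|F| ^ n).-1 ^ d)%N.
  rewrite (card_ffun_forall (fun _ v => v != 0)) prod_nat_const card_ord.
  have -> : (#|F| ^ n = #|{: 'rV[F]_n}|)%N by rewrite card_mx mul1n.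
  by rewrite -(cardC1 (0 : 'rV[F]_n)).
apply/subset_leq_card/subsetP => a; rewrite !inE => /forallP a_neq0.
by rewrite tofrac_eq0 prod_form_neq0.
Qed.

End Product_forms.

(** At a fixed point the surviving tuples are chosen independently in each slot, so their number is
    a product of [d] one-slot counts. *)
Lemma max_rank_prod_form_mx (F : finFieldType) (d n : nat) :
  (max_rank (prod_form_mx F d n.+1) <= (#|F| ^ n.+1 - #|F| ^ n) ^ d)%N.
Proof.
apply/bigmax_leqP => p _; rewrite /eval_mx rank_map_prod_form_mx.
have -> : #|[pred a | meval (fun k => mxvec p 0 k) (prod_form a) != 0]| =
    #|[pred a : {ffun 'I_d -> 'rV[F]_n.+1} | [forall i, a i *m (row i p)^T != 0]]|.
  (* A product in a field is nonzero iff all its factors are, and a 1-by-1 matrix is nonzero iff its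
     entry is. *)
  apply: eq_card => a; rewrite !inE meval_prod_form prodf_seq_neq0.
  apply/allP/forallP => /= nz i; first apply: contraNneq (nz i (mem_index_enum i)).
    by move->; rewrite mxE.
  by move=> _; apply: contraNneq (nz i) => nz0; rewrite [_ *m _]mx11_scalar nz0 raddf0.
rewrite (card_ffun_forall (fun i v => v *m (row i p)^T != 0)).
rewrite -[d in leqRHS]card_ord -prod_nat_const; apply: leq_prod => i _.
exact: card_vec_mul_neq0.
Qed.

Lemma Bernoulli_ineq (R : realDomainType) (x : R) (d : nat) :
  0 <= x <= 1 -> 1 - d%:R * x <= (1 - x) ^+ d.
Proof.
move=> /andP[x_ge0 x_le1]; elim: d => [|d IHd]; first by rewrite mul0r subr0.
rewrite exprSr; apply: le_trans (ler_wpM2r _ IHd); last by rewrite subr_ge0.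
rewrite mulrBr mulr1 mulrBl mul1r -natr1 mulrDl mul1r opprD addrA opprB.
by rewrite lerD2l lerDr; rewrite !mulr_ge0.
Qed.

Theorem proposition5p5 (R : realType) (F : finFieldType) (d : nat) (c : R)
    (hc : (1 - 1 / #|F|%:R) ^+ d < c) :
  exists (n : nat) (r s : nat) (M : 'M[{mpoly F[d * n]}]_(r, s)),
    [/\ (0 < n)%N, multilinear_mx M & (max_rank M)%:R < c * (comm_rank M)%:R].
Proof.
have q_gt1 : (1 < #|F|)%N := card_finNzRing_gt1 F.
have q_gt0 : 0 < #|F|%:R :> R by rewrite ltr0n ltnW.
set t := 1 - 1 / _ in hc.
have t_ge0 : 0 <= t by rewrite subr_ge0 ler_pdivrMr // mul1r ler1n ltnW.
have c_gt0 : 0 < c by apply: le_lt_trans hc; rewrite exprn_ge0.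
(* Chosen so that [Q = #|F| ^ n.+1], which exceeds [n], satisfies [t ^+ d < c * (1 - d / Q)]. *)
pose n := Num.bound (c * d%:R / (c - t ^+ d)).
have Q_gt0 : 0 < #|F|%:R ^+ n.+1 :> R by rewrite exprn_gt0.
have large_n : c * d%:R < (c - t ^+ d) * #|F|%:R ^+ n.+1.
  rewrite [ltRHS]mulrC -ltr_pdivrMr ?subr_gt0 //.
  apply: lt_le_trans (archi_boundP _) _.
    by rewrite divr_ge0 ?mulr_ge0 ?subr_ge0 // ltW.
  by rewrite -natrX ler_nat ltnW // ltnW // ltn_expl.
exists n.+1, _, _, (prod_form_mx F d n.+1); split=> //.
  exact: prod_form_mx_multilinear.
have le_max := max_rank_prod_form_mx F d n.
have le_comm := comm_rank_prod_form_mx F d n.+1.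
move: le_max le_comm; rewrite -!(ler_nat R) !natrX => le_max le_comm.
apply: le_lt_trans le_max _; apply: lt_le_trans (ler_wpM2l (ltW c_gt0) le_comm).
set Q := #|F|%:R ^+ n.+1 in Q_gt0 large_n.
(* Both bounds are written as [d]-th powers of multiples of [Q], so that [Q ^+ d] cancels and
   [t ^+ d < c * (1 - Q^-1) ^+ d] remains. *)
have -> : (#|F| ^ n.+1 - #|F| ^ n)%:R = t * Q.
  rewrite natrB ?leq_exp2l // !natrX mulrBl !mul1r; congr (_ - _).
  by rewrite /Q exprS mulrA mulVf ?mul1r // gt_eqF.
have -> : (#|F| ^ n.+1).-1%:R = (1 - Q^-1) * Q.
  rewrite -subn1 natrB ?expn_gt0 ?(ltnW q_gt1) // natrX -/Q.
  by rewrite mulrBl mul1r mulVf // gt_eqF.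
have Q_ge1 : 1 <= Q by rewrite exprn_ege1 // ler1n ltnW.
clearbody Q; rewrite !exprMn mulrA ltr_pM2r ?exprn_gt0 //.
(* Bernoulli at [x = Q^-1] reduces the goal to the inequality secured by the choice of [n]. *)
apply: lt_le_trans (ler_wpM2l (ltW c_gt0) (Bernoulli_ineq d _)); last first.
  by rewrite invr_ge0 ltW //= invf_le1.
by rewrite mulrBr mulr1 ltrBrDl -ltrBrDr mulrA ltr_pdivrMr.
Qed.
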